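(* Let $G$ be a finite connected simple graph on the vertex set $[d]=\{1,\dots,d\}$ with $e$ edges and with $\delta(G) \ge 2$. Then for any real numbers $\alpha$ and $\beta$ with $2 \le \alpha \le \delta(G)$ and $\beta \ge \omega(G)$, $$c_4(G) \le \frac{(2e-\alpha d)^2}{8}\left(1-\frac{1}{\beta}\right) + \frac{e(d-\alpha^2+1)}{4} + \frac{\alpha-2}{4}\Sigma_2.$$ Moreover, $$c_4(G) = \frac{(2e-\delta(G) d)^2}{8}\left(1-\frac{1}{\omega(G)}\right) + \frac{e(d-\delta(G)^2+1)}{4} + \frac{\delta(G)-2}{4}\Sigma_2$$ holds if and only if $G$ is either the complete graph $K_d$ or the complete bipartite graph $K_{m,m}$ with $d=2m$.
   Context: $c_4(G)$ is the number of subgraphs of $G$ isomorphic to the $4$-cycle $C_4$. $\delta(G)$ is the minimum degree of $G$. $\omega(G)$ (the clique number) is the maximum number of vertices of a complete subgraph of $G$. $\Sigma_2 = \sum_{i=1}^d \deg_G(i)^2$. *)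

(* Defs.v *)
From HB Require Import structures.
From mathcomp Require Import all_boot all_order all_algebra.
From mathcomp Require Import reals.

Set Implicit Arguments.
Unset Strict Implicit.
Unset Printing Implicit Defensive.

Record sgraph (T : finType) := SGraph {
  adj :> rel T;
  adj_sym : symmetric adj;
  adj_irr : irreflexive adj
}.

Definition isomorphic (T U : finType) (r : rel T) (s : rel U) : bool :=
  [exists f : {ffun T -> U},
    [&& injectiveb f, [forall u, u \in codom f]
      & [forall x, forall y, s (f x) (f y) == r x y]]].

Section Invariants.

Variables (T : finType) (G : sgraph T).

Definition connected_graph : Prop :=
  0 < #|T| /\ forall x y : T, connect G x y.

Definition edges : {set {set T}} :=
  [set [set p.1; p.2] | p : T * T & G p.1 p.2].

Definition deg (x : T) : nat := #|[set y | G x y]|.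

(* Every degree is less than #|T| when T is nonempty, so the neutral value
   #|T| never affects the minimum; the empty graph gets the value 0. *)
Definition min_degree : nat := \big[minn/#|T|]_(x : T) deg x.

Definition is_clique (A : {set T}) : bool :=
  [forall x in A, forall y in A, (x != y) ==> G x y].

Definition clique_number : nat := \max_(A : {set T} | is_clique A) #|A|.

(* A subgraph is a pair (vertex set, edge set); it need not be induced. *)
Definition is_subgraph (H : {set T} * {set {set T}}) : bool :=
  (H.2 \subset edges) && [forall a in H.2, a \subset H.1].

Definition subgraph_adj (H : {set T} * {set {set T}}) : rel {x : T | x \in H.1} :=
  fun x y => [set val x; val y] \in H.2.

Definition cycle4 : rel 'I_4 := fun i j => (j == ordS i) || (i == ordS j).

Definition c4 : nat :=
  #|[set H : {set T} * {set {set T}} |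
      is_subgraph H && isomorphic (@subgraph_adj H) cycle4]|.

Definition sum_sq_deg : nat := \sum_(x : T) deg x ^ 2.

End Invariants.

Definition complete_adj (n : nat) : rel 'I_n := fun x y => x != y.

Definition complete_bipartite_adj (p q : nat) : rel ('I_p + 'I_q)%type :=
  fun u v => match u, v with
             | inl _, inr _ | inr _, inl _ => true
             | _, _ => false
             end.

(* Main.v *)
Require Import Defs.
From HB Require Import structures.
From mathcomp Require Import all_boot all_order all_algebra.
From mathcomp Require Import reals.
From mathcomp Require Import zify ring.

(* Write [d] for the number of vertices. An ordered edge uv lies on as many
   labelled 4-cycles as there are adjacent pairs x in N(v) \ u, y in N(u) \ v.
   Of the (deg u - 1)(deg v - 1) pairs, the diagonal ones number
   |N(u) /\ N(v)| = deg u + deg v - |N(u) \/ N(v)| >= deg u + deg v - d.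
   Summing over the edges bounds 8 c_4 in terms of the sum of deg u * deg v,
   and the Motzkin-Straus inequality with the weights deg u - alpha >= 0 bounds
   that sum. Hence 8 times (right side - c_4) is exactly the sum of two
   non-negative terms, the total deficit of the edge counts and the
   Motzkin-Straus gap. If the deficit is 0, a triangle forces all its vertices
   to be universal and G to be complete; without triangles G is complete
   bipartite, one end of every edge has minimum degree, and the gap vanishes
   only if G is regular. *)

Set Implicit Arguments.
Unset Strict Implicit.
Unset Printing Implicit Defensive.

Import Order.TTheory GRing.Theory Num.Theory.

(** * Functions on four indices and the symmetries of the 4-cycle *)

Local Notation i4 k := (@Ordinal 4 k isT).

Lemma enum_ord4 : enum 'I_4 = [:: i4 0; i4 1; i4 2; i4 3].
Proof. by apply: (inj_map val_inj); rewrite val_enum_ord. Qed.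

Lemma forall_ord4 (P : pred 'I_4) :
  [forall i, P i] = [&& P (i4 0), P (i4 1), P (i4 2) & P (i4 3)].
Proof.
have -> : [forall i, P i] = all P (enum 'I_4).
  by apply/forallP/allP => [H i _ | H i]; apply: H; rewrite mem_enum.
by rewrite enum_ord4 /= andbT.
Qed.

Lemma injectiveb_ord4 (T : eqType) (f : 'I_4 -> T) :
  injectiveb f = uniq [:: f (i4 0); f (i4 1); f (i4 2); f (i4 3)].
Proof. by rewrite /injectiveb /dinjectiveb enum_ord4. Qed.

Lemma card_ffun4 (T : finType) (P : T -> T -> T -> T -> bool) :
  #|[set f : {ffun 'I_4 -> T} | P (f (i4 0)) (f (i4 1)) (f (i4 2)) (f (i4 3))]|
  = \sum_a \sum_b \sum_c \sum_d P a b c d.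
Proof.
pose mk (p : T * T * T * T) : {ffun 'I_4 -> T} :=
  [ffun i : 'I_4 => nth p.2 [:: p.1.1.1; p.1.1.2; p.1.2; p.2] i].
have mkK : bijective mk.
  exists (fun f : {ffun 'I_4 -> T} => (f (i4 0), f (i4 1), f (i4 2), f (i4 3))).
    by case=> [[[a b] c] e]; rewrite !ffunE.
  by move=> f; apply/ffunP => -[[|[|[|[|i]]]] Hi] //; rewrite ffunE /=;
    congr (f _); apply: val_inj.
rewrite !pair_bigA /= -sum1_card (eq_bigl _ _ (in_set _)) big_mkcond.
rewrite (reindex mk) /=; last exact: onW_bij.
by apply: eq_bigr => -[[[a b] c] e] _; rewrite !ffunE /=; case: (P a b c e).
Qed.

(** An injective map of the index cycle to itself that preserves edges is an automorphism, so this
    is the dihedral group of order 8. *)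
Definition cycle4_aut : {set {ffun 'I_4 -> 'I_4}} :=
  [set s : {ffun 'I_4 -> 'I_4} | injectiveb s & [forall i, cycle4 (s i) (s (ordS i))]].

Lemma ordS4 : (ordS (i4 0) = i4 1) * (ordS (i4 1) = i4 2) *
              (ordS (i4 2) = i4 3) * (ordS (i4 3) = i4 0).
Proof. by do !split; apply: val_inj. Qed.

Lemma card_cycle4_aut : #|cycle4_aut| = 8.
Proof.
pose P (a b c e : nat) := uniq [:: a; b; c; e] &&
  all (fun p : nat * nat => (p.2 == p.1.+1 %% 4) || (p.1 == p.2.+1 %% 4))
     [:: (a, b); (b, c); (c, e); (e, a)].
transitivity (\sum_(a < 4) \sum_(b < 4) \sum_(c < 4) \sum_(e < 4) P a b c e).
  rewrite -(card_ffun4 (fun a b c e : 'I_4 => P a b c e)); apply: eq_card => s.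
  by rewrite !inE injectiveb_ord4 forall_ord4 !ordS4 /P /cycle4 /= !inE -!val_eqE /= !andbT.
(* The sums over ordinals become sums over ranges of natural numbers, which can be evaluated by
   computation. *)
rewrite -(big_mkord predT (fun a => \sum_(b < 4) \sum_(c < 4) \sum_(e < 4) P a b c e)).
under eq_bigr => a _.
  rewrite -(big_mkord predT (fun b => \sum_(c < 4) \sum_(e < 4) P a b c e)).
  under eq_bigr => b _.
    rewrite -(big_mkord predT (fun c => \sum_(e < 4) P a b c e)).
    under eq_bigr => c _ do rewrite -(big_mkord predT (fun e => P a b c e : nat)).
  over.
over.
by rewrite unlock; vm_compute.
Qed.

Lemma set2_eqP (T : finType) (a b c e : T) :
  reflect ((a = c /\ b = e) \/ (a = e /\ b = c)) ([set a; b] == [set c; e]).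
Proof.
apply: (iffP eqP) => [E | [[-> ->]|[-> ->]]] //; last by rewrite setUC.
have := set21 a b; have := set22 a b; have := set21 c e; have := set22 c e.
rewrite {1 2}E -{1 2}E !inE.
move=> /orP[]/eqP H1 /orP[]/eqP H2 /orP[]/eqP H3 /orP[]/eqP H4;
  subst; tauto.
Qed.

(** * Labelled 4-cycles, and their count along ordered edges *)

Section FourCycles.

Variables (T : finType) (G : sgraph T).

Definition labelled_c4 : {set {ffun 'I_4 -> T}} :=
  [set f : {ffun 'I_4 -> T} | injectiveb f & [forall i, G (f i) (f (ordS i))]].

Definition cycle_subgraph (f : {ffun 'I_4 -> T}) : {set T} * {set {set T}} :=
  (f @: setT, [set [set f i; f (ordS i)] | i in setT]).

Lemma cycle_edgeP (f : {ffun 'I_4 -> T}) i j : injective f ->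
  ([set f i; f j] \in (cycle_subgraph f).2) = cycle4 i j.
Proof.
move=> finj; apply/imsetP/orP => [[k _ /eqP/set2_eqP] | [/eqP->|/eqP->]].
- by case=> -[/finj-> /finj->]; rewrite eqxx; [left|right].
- by exists i.
- by exists j; rewrite // setUC.
Qed.

Lemma labelled_c4_adj f i j : f \in labelled_c4 -> cycle4 i j -> G (f i) (f j).
Proof.
rewrite inE => /andP[_ /forallP H] /orP[]/eqP-> //.
by rewrite (adj_sym G).
Qed.

Lemma labelled_c4_inj f : f \in labelled_c4 -> injective f.
Proof. by rewrite inE => /andP[/injectiveP]. Qed.

Lemma card_cycle_edges (f : {ffun 'I_4 -> T}) :
  injective f -> #|(cycle_subgraph f).2| = 4.
Proof.
move=> finj; rewrite card_imset ?cardsT ?card_ord // => i j /eqP/set2_eqP[].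
  by case=> /finj.
(* Swapped ends would make the double successor of [j] equal to [j], which fails modulo 4. *)
case=> /finj Hi /finj Hj; move: Hj; rewrite Hi => /(congr1 val) /=.
by case: j {Hi} => -[|[|[|[|j]]]].
Qed.

(** Labellings of the same subgraph are exactly the composites of [f0] with an automorphism of the
    index cycle. *)
Lemma cycle_subgraph_fiber f0 : f0 \in labelled_c4 ->
  #|[set f in labelled_c4 | cycle_subgraph f == cycle_subgraph f0]| = 8.
Proof.
move=> Lf0; have f0inj := labelled_c4_inj Lf0.
pose F (s : {ffun 'I_4 -> 'I_4}) : {ffun 'I_4 -> T} := [ffun i => f0 (s i)].
have Finj : injective F.
  by move=> s t /ffunP E; apply/ffunP => i; move: (E i); rewrite !ffunE => /f0inj.
rewrite -card_cycle4_aut -(card_imset _ Finj); apply: eq_card => f.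
rewrite inE; apply/andP/imsetP => [[Lf /eqP E] | [s]].
  have finj := labelled_c4_inj Lf.
  have Hs i : exists k, f i == f0 k.
    have : f i \in (cycle_subgraph f).1 by apply: imset_f.
    by rewrite E => /imsetP[k _ ->]; exists k.
  (* [s] sends [i] to the index at which [f0] takes the value [f i]. *)
  pose s : {ffun 'I_4 -> 'I_4} := [ffun i => xchoose (Hs i)].
  have sE i : f i = f0 (s i) by rewrite ffunE; apply/eqP/(xchooseP (Hs i)).
  exists s; last by apply/ffunP => i; rewrite ffunE.
  rewrite inE; apply/andP; split.
    by apply/injectiveP => i j E'; apply: finj; rewrite !sE E'.
  apply/forallP => i; rewrite -(cycle_edgeP _ _ f0inj) -E -!sE.
  by rewrite cycle_edgeP // /cycle4 eqxx.
rewrite inE => /andP[/injectiveP sinj /forallP Hs] ->.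
have fsinj : injective (F s) by move=> i j; rewrite !ffunE => /f0inj/sinj.
split.
  rewrite inE; apply/andP; split; first exact/injectiveP.
  by apply/forallP => i; rewrite !ffunE; apply: labelled_c4_adj.
(* Both components of the relabelled cycle lie inside those of [f0] and have the same
   cardinality. *)
apply/eqP; congr (_, _); apply/eqP; rewrite eqEcard; apply/andP; split.
- by apply/subsetP => _ /imsetP[i _ ->]; rewrite ffunE imset_f.
- by rewrite !card_imset.
- apply/subsetP => _ /imsetP[i _ ->].
  by rewrite !ffunE cycle_edgeP.
- by rewrite (card_cycle_edges fsinj) (card_cycle_edges f0inj).
Qed.

(** An isomorphism onto the index cycle, once inverted, is a labelling; conversely, a labelling is
    injective and can be inverted on its image. *)
Lemma c4_subgraphsE :
  [set H : {set T} * {set {set T}} |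
      is_subgraph G H && isomorphic (@subgraph_adj T H) cycle4]
  = cycle_subgraph @: labelled_c4.
Proof.
apply/setP => H; rewrite inE; apply/idP/imsetP.
  case: H => V E /andP[/andP[/= /subsetP EG /forall_inP EV]].
  case/existsP => g /and3P[/injectiveP ginj /forallP gsurj /forallP giso].
  pose f : {ffun 'I_4 -> T} := [ffun i => val (iinv (gsurj i))].
  have gf i (Vi : f i \in V) : g (Sub (f i) Vi) = i.
    by rewrite -[RHS](f_iinv (gsurj i)); congr (g _); apply: val_inj; rewrite /= ffunE.
  have fV i : f i \in V by rewrite ffunE; apply: valP.
  have fg x : f (g x) = val x.
    by rewrite ffunE; congr val; apply: ginj; rewrite f_iinv.
  have finj : injective f.
    by move=> i j Eij; rewrite -(gf i (fV i)) -(gf j (fV j)); congr (g _); apply: val_inj.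
  have fE i j : cycle4 i j = ([set f i; f j] \in E).
    have /forallP/(_ (Sub (f j) (fV j)))/eqP := giso (Sub (f i) (fV i)).
    by rewrite !gf.
  have Ef e : (e \in E) -> exists i j, [/\ e = [set f i; f j] & G (f i) (f j)].
    move=> eE; have /imsetP[[a b] /= ] := EG _ eE; rewrite inE /= => Gab Ee.
    have /subsetP eV := EV _ eE.
    have Va : a \in V by apply: eV; rewrite Ee set21.
    have Vb : b \in V by apply: eV; rewrite Ee set22.
    exists (g (Sub a Va)), (g (Sub b Vb)); by rewrite !fg.
  exists f.
    rewrite inE; apply/andP; split; first exact/injectiveP.
    apply/forallP => i.
    have : [set f i; f (ordS i)] \in E by rewrite -fE /cycle4 eqxx.
    case/EG/imsetP => -[a b]; rewrite inE /= => Gab /eqP/set2_eqP[] [-> ->] //.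
    by rewrite (adj_sym G).
  congr (_, _); apply/setP => x; apply/idP/imsetP => [Hx | [i _ ->]] //.
  - by exists (g (Sub x Hx)); rewrite // fg.
  - have [i [j [Ex _]]] := Ef _ Hx; move: Hx; rewrite Ex -fE => /orP[]/eqP->.
      by exists i.
    by exists j; rewrite // setUC.
  - by rewrite -fE /cycle4 eqxx.
case=> f Lf ->{H}; have finj := labelled_c4_inj Lf.
apply/andP; split.
  apply/andP; split => /=.
    apply/subsetP => _ /imsetP[i _ ->]; apply/imsetP.
    by exists (f i, f (ordS i)); rewrite // inE /= labelled_c4_adj // /cycle4 eqxx.
  apply/forall_inP => _ /imsetP[i _ ->]; apply/subsetP => x.
  by rewrite !inE => /orP[]/eqP->; apply: imset_f.
set V := (cycle_subgraph f).1.
have Hg (x : {x | x \in V}) : exists i, val x == f i.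
  by case: x => x /= /imsetP[i _ ->]; exists i.
pose g : {ffun {x | x \in V} -> 'I_4} := [ffun x => xchoose (Hg x)].
have gE x : val x = f (g x) by rewrite ffunE; apply/eqP/(xchooseP (Hg x)).
apply/existsP; exists g; apply/and3P; split.
- by apply/injectiveP => x y Exy; apply: val_inj; rewrite !gE Exy.
- apply/forallP => i; have Vi : f i \in V by apply: imset_f.
  apply/codomP; exists (Sub (f i) Vi); apply: finj; by rewrite -gE.
- apply/forallP => x; apply/forallP => y.
  by rewrite /subgraph_adj !gE cycle_edgeP.
Qed.

Lemma card_labelled_c4 : #|labelled_c4| = 8 * c4 G.
Proof.
rewrite /c4 c4_subgraphsE -sum1_card.
rewrite (partition_big_imset cycle_subgraph) /= mulnC -sum_nat_const.
apply: eq_bigr => _ /imsetP[f0 Lf0 ->].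
rewrite -(cycle_subgraph_fiber Lf0) -sum1_card.
by apply: eq_bigl => f; rewrite inE.
Qed.

(** Handshake count: an edge comes from exactly two ordered pairs, which differ because adjacency is
    irreflexive. *)
Lemma double_card_edges : 2 * #|edges G| = \sum_x deg G x.
Proof.
have -> : \sum_x deg G x = #|[set p : T * T | G p.1 p.2]|.
  rewrite -sum1_card (eq_bigl _ _ (in_set _)) .
  transitivity (\sum_x \sum_y if G x y then 1 else 0);
    last by rewrite pair_bigA [RHS]big_mkcond.
  apply: eq_bigr => x _; rewrite /deg -sum1_card -big_mkcond.
  by apply: eq_bigl => y; rewrite inE.
rewrite -[RHS]sum1_card (partition_big_imset (fun p : T * T => [set p.1; p.2])) /=.
rewrite mulnC -sum_nat_const; apply: eq_big => [e|e /imsetP[[a b]]].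
  by congr (e \in _); apply: eq_imset.
rewrite inE /= => Gab ->.
have ab : a != b by apply/eqP => E; move: Gab; rewrite E (adj_irr G).
have -> : 2 = #|[set (a, b); (b, a)]| by rewrite cards2 xpair_eqE (negPf ab).
rewrite -sum1_card; apply: eq_bigl => -[x y]; rewrite !inE /= !xpair_eqE.
apply/idP/andP => [|[_ /set2_eqP[] [-> ->]]]; rewrite ?eqxx ?orbT //.
by case/orP => /andP[/eqP-> /eqP->]; rewrite ?(adj_sym G b a) Gab ?eqxx // setUC eqxx.
Qed.

(** The cycle is read as [u], [v], [p.1], [p.2]; two inequalities cover the opposite vertices, and
    adjacency separates consecutive ones. *)
Definition cycles_through (u v : T) : nat :=
  #|[set p : T * T | [&& G v p.1, p.1 != u, G u p.2, p.2 != v & G p.1 p.2]]|.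

(* The amount by which an edge misses the bound on the number of 4-cycles
   through it. *)
Definition deficit (u v : T) : nat :=
  #|[set p : T * T |
      [&& G v p.1, p.1 != u, G u p.2, p.2 != v, p.1 != p.2 & ~~ G p.1 p.2]]|
  + #|[set z | ~~ G u z && ~~ G v z]|.

(** Each subgraph has 8 labellings, and these are grouped by their first two vertices. *)
Lemma c4_edge_count : 8 * c4 G = \sum_u \sum_(v | G u v) cycles_through u v.
Proof.
rewrite -card_labelled_c4.
pose P a b c e := uniq [:: a; b; c; e] && [&& G a b, G b c, G c e & G e a].
transitivity (\sum_a \sum_b \sum_c \sum_e P a b c e).
  rewrite -(card_ffun4 P); apply: eq_card => f.
  by rewrite !inE injectiveb_ord4 forall_ord4 !ordS4.
apply: eq_bigr => a _; rewrite [RHS]big_mkcond; apply: eq_bigr => b _.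
rewrite pair_bigA /=; case: ifPn => [Gab | /negPf Gab]; last first.
  by rewrite big1 // => -[c e] _; rewrite /P Gab andbF.
rewrite /cycles_through -sum1_card (eq_bigl _ _ (in_set _)) [RHS]big_mkcond.
apply: eq_bigr => -[c e] _; rewrite /= /P /= !inE Gab andbT /=.
rewrite (adj_sym G e a).
case Gbc: (G b c); rewrite ?andbF //=; case Gae: (G a e); rewrite ?andbF //=.
case Gce: (G c e); rewrite ?andbF //=.
have neq x y : G x y -> x == y = false.
  by move=> H; apply/negP => /eqP E; move: H; rewrite E (adj_irr G).
rewrite (neq _ _ Gab) (neq _ _ Gbc) (neq _ _ Gce) (neq _ _ Gae) /= orbF.
by rewrite (eq_sym c a) (eq_sym e b) !andbT; do 2!case: (_ == _).
Qed.

(** The pairs in [setX (Nv :\ u) (Nu :\ v)] are adjacent, diagonal, or counted by [deficit].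
    Inclusion-exclusion evaluates the diagonal ones; negative terms are moved across to stay in the
    natural numbers. *)
Lemma edge_count u v : G u v ->
  cycles_through u v + deficit u v + 2 * (deg G u + deg G v)
  = deg G u * deg G v + #|T| + 1.
Proof.
move=> Guv; set Nu := [set y | G u y]; set Nv := [set y | G v y].
have uNv : u \in Nv by rewrite inE (adj_sym G).
have vNu : v \in Nu by rewrite inE.
have du : deg G u = #|Nu :\ v|.+1 by rewrite /deg (cardsD1 v) vNu.
have dv : deg G v = #|Nv :\ u|.+1 by rewrite /deg (cardsD1 u) uNv.
have hX := cardsX (Nv :\ u) (Nu :\ v).
set X := setX _ _ in hX.
have h1 := cardsID [set p : T * T | G p.1 p.2] X.
have h2 := cardsID [set p : T * T | p.1 == p.2] (X :\: [set p : T * T | G p.1 p.2]).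
have e1 : #|X :&: [set p : T * T | G p.1 p.2]| = cycles_through u v.
  apply: eq_card => -[x y]; rewrite !inE /=.
  by case: (x == u); case: (y == v); case: (G v x); case: (G u y); case: (G x y).
have e2 : #|(X :\: [set p : T * T | G p.1 p.2]) :&: [set p : T * T | p.1 == p.2]|
          = #|Nu :&: Nv|.
  (* By irreflexivity, a common neighbour differs from [u] and [v], and its diagonal pair is never
     adjacent. *)
  rewrite -(card_imset _ (_ : injective (fun x : T => (x, x)))); last by move=> x y [].
  apply: eq_card => -[x y]; rewrite !inE /=; apply/idP/imsetP.
    case/andP => /andP[_ /andP[/andP[_ h] /andP[_ h']]] /eqP E.
    by move: h h'; rewrite E => h h'; exists y; rewrite // !inE h h'.
  case=> z; rewrite !inE => /andP[h h'] [-> ->].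
  rewrite h h' eqxx (adj_irr G) /= !andbT; apply/andP; split.
    by apply/eqP => E; move: h; rewrite E (adj_irr G).
  by apply/eqP => E; move: h'; rewrite E (adj_irr G).
set D1 := #|_ :\: [set p : T * T | p.1 == p.2]| in h2.
have e3 : deficit u v = D1 + #|~: (Nu :|: Nv)|.
  rewrite /deficit; congr (_ + _); apply: eq_card => x; rewrite !inE ?negb_or //.
  case: x => x y /=.
  by case: (x == u); case: (y == v); case: (G v x); case: (G u y); case: (G x y);
    case: (x == y).
have h3 := cardsUI Nu Nv; have h4 := cardsC (Nu :|: Nv).
have du' : #|Nu| = deg G u by []. have dv' : #|Nv| = deg G v by [].
move: h1 h2 hX h3 h4; rewrite e1 e2 e3 du' dv' du dv mulSn mulnS; lia.
Qed.

End FourCycles.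

Local Open Scope ring_scope.

(** * The Motzkin-Straus inequality for non-negative vertex weights *)

Section MotzkinStraus.

Variables (T : finType) (G : sgraph T) (R : realFieldType).

(** Each edge is counted in both orders, so the Motzkin-Straus constant is
    [1 - 1 / clique_number G], without the factor one half. *)
Definition edge_form (x : T -> R) : R := \sum_u \sum_(v | G u v) x u * x v.

(* The quadratic term vanishes because [i] and [j] are not adjacent. *)
Lemma edge_form_shift (x : T -> R) (i j : T) (t : R) : ~~ G i j ->
  edge_form (fun k => x k + t * ((k == i)%:R - (k == j)%:R))
  = edge_form x + 2 * t * (\sum_(v | G i v) x v - \sum_(v | G j v) x v).
Proof.
move=> Gij; pose h k : R := (k == i)%:R - (k == j)%:R.
(* [B] is the symmetric bilinear form with [edge_form x = B x x]; it is expanded at [x + t * h]. *)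
pose B (x y : T -> R) := \sum_u \sum_(v | G u v) x u * y v.
have sum_h (F : T -> R) : \sum_u h u * F u = F i - F j.
  rewrite /h; under eq_bigr => u _ do rewrite mulrBl.
  rewrite sumrB (bigD1 i) //= eqxx big1 => [|u /negPf->]; last by rewrite mul0r.
  rewrite (bigD1 j) //= eqxx [X in _ - (_ + X)]big1 => [|u /negPf->]; last by rewrite mul0r.
  by rewrite !mul1r !addr0.
have Bhy y : B h y = \sum_(v | G i v) y v - \sum_(v | G j v) y v.
  by rewrite /B; under eq_bigr => u _ do rewrite -mulr_sumr; rewrite sum_h.
have BC y z : B y z = B z y.
  rewrite /B (exchange_big_dep xpredT) //=; apply: eq_bigr => u _.
  by apply: eq_big => [v|v _]; [rewrite (adj_sym G) | rewrite mulrC].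
have Gs k : \sum_(v | G k v) h v = (G k i)%:R - (G k j)%:R.
  rewrite big_mkcond -(sum_h (fun v => (G k v)%:R)); apply: eq_bigr => v _.
  by case: (G k v); rewrite ?mulr1 ?mulr0.
have Bhh : B h h = 0.
  by rewrite Bhy !Gs !(adj_irr G) (adj_sym G j i) (negPf Gij) !subrr.
transitivity (B x x + t * B x h + t * B h x + t ^+ 2 * B h h); last first.
  by rewrite Bhh (BC x h) Bhy (_ : edge_form x = B x x) //; ring.
rewrite /edge_form /B !mulr_sumr -!big_split; apply: eq_bigr => u _ /=.
rewrite !mulr_sumr -!big_split; apply: eq_bigr => v _ /=.
by rewrite -/(h u) -/(h v); ring.
Qed.

(** Cauchy-Schwarz, from the non-negativity of the sum of squared deviations from the mean. *)
Lemma sqr_sum_le_card (A : {set T}) (x : T -> R) :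
  (\sum_(k in A) x k) ^+ 2 <= #|A|%:R * \sum_(k in A) x k ^+ 2.
Proof.
have [->|A0] := eqVneq A set0; first by rewrite !big_set0 expr0n mulr0.
have k0 : 0 < #|A|%:R :> R by rewrite ltr0n card_gt0.
set k := #|A|%:R in k0 *; set S := \sum_(k in A) x k.
have : 0 <= \sum_(i in A) (x i - S / k) ^+ 2 by apply: sumr_ge0 => i _; apply: sqr_ge0.
have -> : \sum_(i in A) (x i - S / k) ^+ 2 = \sum_(i in A) x i ^+ 2 - S ^+ 2 / k.
  under eq_bigr => i _ do rewrite sqrrB.
  rewrite big_split sumrB /= sumrMnl -mulr_suml -/S sumr_const -[_ *+ #|A|]mulr_natr -/k.
  by field; rewrite gt_eqF.
by rewrite subr_ge0 ler_pdivrMr // mulrC.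
Qed.

Lemma card_clique_le (A : {set T}) : is_clique G A -> (#|A| <= clique_number G)%N.
Proof. exact: leq_bigmax_cond. Qed.

(** On a clique the form is the squared sum minus the sum of squares, and Cauchy-Schwarz on the
    support bounds the latter from below. *)
Lemma motzkin_straus_clique (x : T -> R) :
  is_clique G [set k | x k != 0] ->
  edge_form x <= (1 - 1 / (clique_number G)%:R) * (\sum_k x k) ^+ 2.
Proof.
set A := [set _ | _] => Acl; have := card_clique_le Acl => Aw.
have sumA (F : T -> R) : (forall k, x k = 0 -> F k = 0) -> \sum_k F k = \sum_(k in A) F k.
  move=> F0; rewrite [RHS]big_mkcond; apply: eq_bigr => k _; rewrite inE.
  by case: eqVneq => //= /F0.
have -> : edge_form x = (\sum_k x k) ^+ 2 - \sum_k x k ^+ 2.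
  apply/eqP; rewrite eq_sym subr_eq; apply/eqP.
  rewrite expr2 mulr_suml /edge_form -big_split; apply: eq_bigr => u _ /=.
  rewrite mulr_sumr (bigD1 u) //= addrC expr2; congr (_ + _).
  rewrite big_mkcond [RHS]big_mkcond; apply: eq_bigr => v _.
  have [->|xu0] := eqVneq (x u) 0; first by rewrite !mul0r !if_same.
  have [->|xv0] := eqVneq (x v) 0; first by rewrite !mulr0 !if_same.
  have [->|vu] := eqVneq v u; first by rewrite (adj_irr G).
  move/forall_inP: Acl => /(_ u); rewrite inE => /(_ xu0) /forall_inP/(_ v).
  by rewrite inE => /(_ xv0); rewrite eq_sym vu => /= ->.
rewrite mulrBl !mul1r lerD2l lerN2.
rewrite (sumA x) // (sumA (fun k => x k ^+ 2)); last by move=> k ->; rewrite expr0n.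
have [A0|A0] := posnP #|A|; first by rewrite (cards0_eq A0) !big_set0 expr0n mulr0.
rewrite ler_pdivrMl; last by rewrite ltr0n (leq_trans A0).
apply: le_trans (sqr_sum_le_card _ _) _; rewrite ler_wpM2r ?ler_nat //.
by apply: sumr_ge0 => i _; apply: sqr_ge0.
Qed.

(* Moving the whole weight of one of two non-adjacent vertices onto the other
   changes the form linearly, hence does not decrease it in one of the two
   directions; this shrinks the support until it is a clique. *)
Lemma motzkin_straus (x : T -> R) : (forall k, 0 <= x k) ->
  edge_form x <= (1 - 1 / (clique_number G)%:R) * (\sum_k x k) ^+ 2.
Proof.
have [n] := ubnP #|[set k | x k != 0]|; elim: n => // n IHn in x * => Hn x0.
have [/motzkin_straus_clique //|] := boolP (is_clique G [set k | x k != 0]).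
case/forall_inPn => i; rewrite inE => xi /forall_inPn[j]; rewrite inE => xj.
rewrite negb_imply => /andP[ij Gij].
(* The roles of [i] and [j] are symmetric: weight is moved to the vertex with the heavier
   neighbourhood. *)
wlog gij : i j xi xj ij Gij / \sum_(v | G j v) x v <= \sum_(v | G i v) x v => [W|].
  have [h|/ltW h] := leP (\sum_(v | G j v) x v) (\sum_(v | G i v) x v).
    exact: (W i j).
  by apply: (W j i); rewrite // 1?eq_sym // (adj_sym G).
(* The shift by [x j] empties [j] while keeping all weights non-negative and the total unchanged. *)
pose y k := x k + x j * ((k == i)%:R - (k == j)%:R).
have yj : y j = 0 by rewrite /y eqxx eq_sym (negPf ij) sub0r mulrN1 subrr.
have yk k : k != j -> y k = x k + x j * (k == i)%:R.
  by move=> /negPf kj; rewrite /y kj subr0.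
have y0 k : 0 <= y k.
  have [->|/yk->] := eqVneq k j; first by rewrite yj.
  by rewrite addr_ge0 // mulr_ge0.
have sy : \sum_k y k = \sum_k x k.
  rewrite /y big_split /= -mulr_sumr sumrB.
  have one (l : T) : \sum_k (k == l)%:R = 1 :> R.
    by rewrite (bigD1 l) //= eqxx big1 ?addr0 // => k /negPf->.
  by rewrite !one subrr mulr0 addr0.
rewrite -sy; apply: le_trans (IHn y _ y0); last first.
  move: Hn; rewrite ltnS; apply: leq_trans.
  apply: proper_card; apply/properP; split; last first.
    by exists j; rewrite !inE ?yj ?eqxx.
  apply/subsetP => k; rewrite !inE; have [->|kj] := eqVneq k j; first by rewrite yj eqxx.
  have [->//|ki] := eqVneq k i.
  by rewrite yk // (negPf ki) mulr0 addr0.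
by rewrite edge_form_shift // lerDl mulr_ge0 ?subr_ge0 // mulr_ge0.
Qed.

End MotzkinStraus.

(** * Degrees, cliques, and graphs with total deficit zero *)

Section Structure.

Variables (T : finType) (G : sgraph T).

Definition total_deficit : nat := \sum_u \sum_(v | G u v) deficit G u v.

Lemma min_degree_le x : (min_degree G <= deg G x)%N.
Proof.
rewrite /min_degree; have := mem_index_enum x.
elim: (index_enum T) => // y r IHr; rewrite inE big_cons geq_min.
by case/orP => [/eqP<-|/IHr->]; rewrite ?leqnn ?orbT.
Qed.

Lemma deg_lt_card x : (deg G x < #|T|)%N.
Proof.
rewrite -cardsT; apply: proper_card; apply/properP; split; first exact: subsetT.
by exists x; rewrite ?inE ?(adj_irr G).
Qed.

Lemma min_degree_attained (x0 : T) : exists x, min_degree G = deg G x.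
Proof.
have [//|] := eqVneq (min_degree G) #|T|.
  by move=> E; move: (min_degree_le x0); rewrite E leqNgt deg_lt_card.
(* The induction proves that a value other than the neutral [#|T|] is some degree. *)
rewrite /min_degree; elim/big_ind: _ => [|m n IHm IHn|x _ _]; last by exists x.
  by rewrite eqxx.
by rewrite /minn; case: ifP.
Qed.

Lemma clique_edge x y : G x y -> (2 <= clique_number G)%N.
Proof.
move=> Gxy; have xy : x != y by apply/eqP => E; move: Gxy; rewrite E (adj_irr G).
have <- : #|[set x; y]| = 2%N by rewrite cards2 xy.
apply: card_clique_le; apply/forall_inP => a; rewrite !inE => Ha.
apply/forall_inP => b; rewrite !inE => Hb; apply/implyP.
by case/orP: Ha => /eqP->; case/orP: Hb => /eqP->; rewrite ?eqxx // (adj_sym G).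
Qed.

Lemma total_deficit_eq0P :
  reflect (forall u v, G u v ->
     (forall x y, G v x -> x != u -> G u y -> y != v -> x != y -> G x y)
     /\ (forall z, G u z || G v z))
   (total_deficit == 0%N).
Proof.
rewrite sum_nat_eq0; apply: (iffP forallP) => H u.
  move=> v Guv; have := H u; rewrite sum_nat_eq0 => /forall_inP/(_ v Guv).
  rewrite addn_eq0 !cards_eq0 => /andP[/eqP/setP H1 /eqP/setP H2]; split.
    move=> x y Gx xu Gy yv xy; have := H1 (x, y); rewrite !inE /= Gx xu Gy yv xy.
    by move/negbFE.
  by move=> z; have := H2 z; rewrite !inE -negb_or => /negbFE.
rewrite sum_nat_eq0; apply/forall_inP => v Guv; have [H1 H2] := H u v Guv.
rewrite addn_eq0 !cards_eq0; apply/andP; split; apply/eqP/setP.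
  case=> x y; rewrite !inE /=; apply/negP => /and5P[Gx xu Gy yv /andP[xy]].
  by rewrite H1.
by move=> z; rewrite !inE -negb_or H2.
Qed.

(** Every [z] is adjacent to [a] or [b] on the edge [ab] of a triangle [abe], and the absence of
    missing pairs then joins [z] to [e]. *)
Lemma triangle_complete u v w :
  total_deficit = 0%N -> G u v -> G u w -> G v w -> forall x y, G x y = (x != y).
Proof.
move=> /eqP/total_deficit_eq0P H.
have univ a b e : G a b -> G a e -> G b e -> forall z, z != e -> G e z.
  move=> Gab Gae Gbe z ze; have [H1 H2] := H a b Gab.
  have ae : e != a by apply/eqP => E; move: Gae; rewrite E (adj_irr G).
  have be : e != b by apply/eqP => E; move: Gbe; rewrite E (adj_irr G).
  have [->|za] := eqVneq z a; first by rewrite (adj_sym G).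
  have [->|zb] := eqVneq z b; first by rewrite (adj_sym G).
  case/orP: (H2 z) => Gz; first by apply: H1; rewrite // eq_sym.
  by rewrite (adj_sym G); apply: H1.
move=> Guv Guw Gvw.
have Uu := univ _ _ _ Gvw (etrans (adj_sym G v u) Guv) (etrans (adj_sym G w u) Guw).
have Uv := univ _ _ _ Guw Guv (etrans (adj_sym G w v) Gvw).
have [H1 _] := H u v Guv.
move=> x y; have [->|xy] := eqVneq x y; first by rewrite (adj_irr G).
have [E|xu] := eqVneq x u; first by rewrite E Uu // -E eq_sym.
have [E|yv] := eqVneq y v; first by rewrite E (adj_sym G) Uv // -E.
have [E|xv] := eqVneq x v; first by rewrite E Uv // -E eq_sym.
have [E|yu] := eqVneq y u; first by rewrite E (adj_sym G) Uu // -E.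
(* Since [u] and [v] are universal, every remaining pair [x], [y] is a candidate pair for the edge
   [uv]. *)
by apply: H1; rewrite // ?Uu ?Uv.
Qed.

(** Without triangles the neighbourhoods of [u] and [v] are complementary. They form the two
    classes, and zero deficit joins every cross pair. *)
Lemma triangle_free_bipartite u v :
  total_deficit = 0%N -> G u v -> (forall a b c, G a b -> G a c -> ~~ G b c) ->
  forall x y, G x y = (G v x (+) G v y).
Proof.
move=> /eqP/total_deficit_eq0P H Guv tf; have [H1 H2] := H u v Guv.
have Guz z : G u z = ~~ G v z.
  apply/idP/idP => [Guz|Nvz]; first exact: tf Guv Guz.
  by have := H2 z; rewrite (negPf Nvz) orbF.
have cross x y : G v x -> ~~ G v y -> G x y.
  move=> Gvx Nvy.
  have [->|xu] := eqVneq x u; first by rewrite Guz.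
  have [->|yv] := eqVneq y v; first by rewrite (adj_sym G).
  apply: H1; rewrite ?Guz //.
  by apply/eqP => E; move: Nvy; rewrite -E Gvx.
move=> x y; case Gvx: (G v x); case Gvy: (G v y) => /=.
- exact/negbTE/(tf v).
- by apply: cross; rewrite ?Gvy.
- by rewrite (adj_sym G); apply: cross; rewrite ?Gvx.
- by apply/negbTE/(tf u); rewrite Guz ?Gvx ?Gvy.
Qed.

Lemma deg_bipartite (A : {set T}) :
  (forall x y, G x y = ((x \in A) (+) (y \in A))) ->
  forall x, deg G x = if x \in A then #|~: A| else #|A|.
Proof.
move=> GE x; rewrite /deg; case: ifP => xA; apply: eq_card => y.
  by rewrite !inE GE xA.
by rewrite !inE GE xA.
Qed.

Lemma bipartite_total_deficit (A : {set T}) :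
  (forall x y, G x y = ((x \in A) (+) (y \in A))) -> total_deficit = 0%N.
Proof.
move=> GE; apply/eqP/total_deficit_eq0P => u v; rewrite GE => Guv; split=> [x y|z].
  rewrite !GE => + _ + _ _; move: Guv.
  by case: (u \in A); case: (v \in A); case: (x \in A); case: (y \in A).
by rewrite !GE; move: Guv; case: (u \in A); case: (v \in A); case: (z \in A).
Qed.

Lemma complete_total_deficit :
  (forall x y, G x y = (x != y)) -> total_deficit = 0%N.
Proof.
move=> GE; apply/eqP/total_deficit_eq0P => u v; rewrite GE => uv.
split=> [x y *|z]; rewrite !GE //.
by case: eqVneq => //= <-; rewrite eq_sym.
Qed.

Lemma deg_complete : (forall x y, G x y = (x != y)) -> forall x, deg G x = #|T|.-1.
Proof.
move=> GE x; rewrite /deg -(cardsC1 x); apply: eq_card => y.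
by rewrite !inE GE eq_sym.
Qed.

Lemma sum_adj_fst (R : pzRingType) (F : T -> R) :
  \sum_u \sum_(v | G u v) F u = \sum_u F u * (deg G u)%:R.
Proof.
apply: eq_bigr => u _; rewrite sumr_const mulr_natr; congr (_ *+ _).
by apply: eq_card => v; rewrite !inE.
Qed.

Lemma sum_adj_snd (R : pzRingType) (F : T -> R) :
  \sum_u \sum_(v | G u v) F v = \sum_u F u * (deg G u)%:R.
Proof.
rewrite -sum_adj_fst (exchange_big_dep xpredT) //=.
by apply: eq_bigr => u _; apply: eq_bigl => v; rewrite (adj_sym G).
Qed.

End Structure.

(** * Recognising complete and balanced complete bipartite graphs *)

Lemma complete_isoP (d : nat) (G : sgraph 'I_d) :
  reflect (forall x y, G x y = (x != y)) (isomorphic G (@complete_adj d)).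
Proof.
apply: (iffP existsP) => [[f /and3P[/injectiveP finj _ /forallP H]] x y | H].
  have /forallP/(_ y)/eqP <- := H x.
  by rewrite /complete_adj (inj_eq finj).
exists [ffun x => x]; apply/and3P; split.
- by apply/injectiveP => x y; rewrite !ffunE.
- by apply/forallP => x; apply/codomP; exists x; rewrite ffunE.
- by apply/forallP => x; apply/forallP => y; rewrite !ffunE H.
Qed.

(** [A] is the preimage of the left summand; conversely, the ranks inside [A] and its complement
    give the isomorphism. *)
Lemma complete_bipartite_isoP (T : finType) (G : sgraph T) (m : nat) :
  reflect (exists A : {set T},
      [/\ #|A| = m, #|~: A| = m & forall x y, G x y = ((x \in A) (+) (y \in A))])
    (isomorphic G (@complete_bipartite_adj m m)).
Proof.
apply: (iffP existsP) => [[f /and3P[/injectiveP finj /forallP fsurj /forallP H]] | ].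
  pose side (w : 'I_m + 'I_m) := if w is inl _ then true else false.
  have fbij : bijective f.
    by exists (fun w => iinv (fsurj w)) => x; rewrite ?f_iinv // iinv_f.
  have card_side b : #|[set x | side (f x) == b]| = m.
    have -> : [set x | side (f x) == b] = f @^-1: [set w | side w == b].
      by apply/setP => x; rewrite !inE.
    rewrite on_card_preimset; last exact: onW_bij.
    rewrite -[RHS](card_ord m).
    pose inj : 'I_m -> 'I_m + 'I_m := if b then inl else inr.
    rewrite -(card_imset _ (_ : injective inj)); last by rewrite /inj; case: (b) => ? ? [].
    apply: eq_card => w; rewrite inE; apply/eqP/imsetP => [|[i _ ->]].
      by rewrite /inj; case: (b); case: w => i //= _; exists i.
    by rewrite /inj; case: (b).
  exists [set x | side (f x)]; split.
  - by rewrite -[RHS](card_side true); apply: eq_card => x; rewrite !inE eqb_id.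
  - by rewrite -[RHS](card_side false); apply: eq_card => x; rewrite !inE eqbF_neg.
  - move=> x y; have /forallP/(_ y)/eqP <- := H x; rewrite !inE.
    by case: (f x) => ?; case: (f y).
case=> A [cA cB GE].
have AC x : (x \in A) = false -> x \in ~: A by rewrite inE => ->.
(* Matching on [boolP] keeps the membership proof that [enum_rank_in] requires. *)
pose f x : 'I_m + 'I_m :=
  match boolP (x \in A) with
  | AltTrue h => inl (cast_ord cA (enum_rank_in h x))
  | AltFalse h => inr (cast_ord cB (enum_rank_in (AC x (negbTE h)) x))
  end.
have fside x y : complete_bipartite_adj (f x) (f y) = ((x \in A) (+) (y \in A)).
  rewrite /f; case: {-}_ / boolP => hx; case: {-}_ / boolP => hy /=;
    by rewrite ?hx ?hy ?(negbTE hx) ?(negbTE hy).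
have finj : injective f.
  move=> x y; rewrite /f; case: {-}_ / boolP => hx; case: {-}_ / boolP => hy //= [];
    move/val_inj.
    by move=> /(congr1 enum_val); rewrite !enum_rankK_in.
  by move=> /(congr1 enum_val); rewrite !enum_rankK_in // inE.
exists [ffun x => f x]; apply/and3P; split.
- by apply/injectiveP => x y; rewrite !ffunE => /finj.
- apply/forallP => w; apply: inj_card_onto => [x y|].
    by rewrite !ffunE => /finj.
  by rewrite card_sum card_ord -(cardsC A) cA cB.
- by apply/forallP => x; apply/forallP => y; rewrite !ffunE fside GE.
Qed.

(** * The exact defect of the bound and the vanishing of the Motzkin-Straus gap *)

Section Gap.

Variables (T : finType) (G : sgraph T) (R : realFieldType).
Implicit Types alpha : R.

(** Slack in Motzkin-Straus for the weights [deg G u - alpha], whose total is the squared quantity;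
    [c] stands for [1 - 1 / beta]. *)
Definition straus_gap alpha (c : R) : R :=
  c * (2 * #|edges G|%:R - alpha * #|T|%:R) ^+ 2
  - edge_form G (fun u => (deg G u)%:R - alpha).

Lemma sum_deg_sub alpha :
  \sum_u ((deg G u)%:R - alpha) = 2 * #|edges G|%:R - alpha * #|T|%:R.
Proof.
by rewrite sumrB sumr_const -natr_sum -double_card_edges natrM -[alpha *+ _]mulr_natr.
Qed.

(** An identity for all [alpha] and [c], from which both the inequality and its equality case are
    read off. *)
Lemma c4_bound_defect alpha c :
  (2 * #|edges G|%:R - alpha * #|T|%:R) ^+ 2 / 8 * c
   + #|edges G|%:R * (#|T|%:R - alpha ^+ 2 + 1) / 4
   + (alpha - 2) / 4 * (sum_sq_deg G)%:R
  = (c4 G)%:R + ((total_deficit G)%:R + straus_gap alpha c) / 8.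
Proof.
pose D u : R := (deg G u)%:R.
have sum1 : \sum_u D u = 2 * #|edges G|%:R.
  by rewrite /D -natr_sum -double_card_edges natrM.
have sum2 : \sum_u D u * D u = (sum_sq_deg G)%:R.
  by rewrite natr_sum; apply: eq_bigr => u _; rewrite natrX expr2.
have sumc (a : R) : \sum_u \sum_(v | G u v) a = a * (2 * #|edges G|%:R).
  by rewrite sum_adj_fst -sum1 mulr_sumr.
(* [edge_count] summed over ordered edges; the terms [2 * (D u + D v)] add up to four times the sum
   of squared degrees. *)
have count : 8 * (c4 G)%:R + (total_deficit G)%:R + 4 * (sum_sq_deg G)%:R
    = \sum_u \sum_(v | G u v) D u * D v + (#|T|%:R + 1) * (2 * #|edges G|%:R).
  rewrite -sumc.
  have -> : 4 * (sum_sq_deg G)%:R = \sum_u \sum_(v | G u v) 2 * (D u + D v).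
    under eq_bigr => u _ do rewrite -mulr_sumr big_split.
    by rewrite -mulr_sumr big_split /= sum_adj_fst sum_adj_snd sum2; ring.
  have -> : 8 * (c4 G)%:R = \sum_u \sum_(v | G u v) (cycles_through G u v)%:R :> R.
    rewrite -(natrM _ 8) c4_edge_count natr_sum.
    by apply: eq_bigr => u _; rewrite natr_sum.
  rewrite /total_deficit natr_sum -!big_split; apply: eq_bigr => u _ /=.
  rewrite natr_sum -!big_split; apply: eq_bigr => v Guv /=.
  have /(congr1 (fun n => n%:R : R)) := edge_count Guv.
  by rewrite /= !(natrD, natrM) -/(D u) -/(D v) => ->; ring.
have form : edge_form G (fun u => D u - alpha) = \sum_u \sum_(v | G u v) D u * D v
    - 2 * alpha * (sum_sq_deg G)%:R + alpha ^+ 2 * (2 * #|edges G|%:R).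
  have -> : 2 * alpha * (sum_sq_deg G)%:R = \sum_u \sum_(v | G u v) alpha * (D u + D v).
    under eq_bigr => u _ do rewrite -mulr_sumr big_split.
    by rewrite -mulr_sumr big_split /= sum_adj_fst sum_adj_snd sum2; ring.
  rewrite -sumc -sumrB -big_split; apply: eq_bigr => u _ /=.
  rewrite -sumrB -big_split; apply: eq_bigr => v _ /=; ring.
rewrite /straus_gap -/D form.
set P := \sum_u _ in count *.
have -> : P = 8 * (c4 G)%:R + (total_deficit G)%:R + 4 * (sum_sq_deg G)%:R
             - (#|T|%:R + 1) * (2 * #|edges G|%:R) by rewrite count; ring.
by field.
Qed.

(** The bound on [alpha] makes the weights non-negative, and enlarging [beta] beyond the clique
    number only increases the constant. *)
Lemma straus_gap_ge0 alpha beta : (0 < clique_number G)%N ->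
  alpha <= (min_degree G)%:R -> (clique_number G)%:R <= beta ->
  0 <= straus_gap alpha (1 - 1 / beta).
Proof.
move=> w0 ha hb; rewrite subr_ge0.
have x0 u : 0 <= (deg G u)%:R - alpha.
  by rewrite subr_ge0 (le_trans ha) // ler_nat min_degree_le.
apply: le_trans (motzkin_straus G x0) _; rewrite sum_deg_sub ler_wpM2r ?sqr_ge0 //.
rewrite lerD2l lerN2 !mul1r lef_pV2 ?posrE ?ltr0n //.
by apply: lt_le_trans hb; rewrite ltr0n.
Qed.

Lemma regular_straus_gap k c :
  (forall x, deg G x = k) -> straus_gap k%:R c = 0.
Proof.
move=> reg; rewrite /straus_gap -sum_deg_sub /edge_form.
rewrite !big1 ?expr0n ?mulr0 ?subr0 // => u _; last by rewrite reg subrr.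
by rewrite big1 // => v _; rewrite reg subrr mul0r.
Qed.

(** Every edge has an end of weight zero, so the form vanishes. The total weight is then zero, and
    so is each non-negative weight. *)
Lemma straus_gap_eq0_regular c : c != 0 ->
  (forall u v, G u v -> deg G u = min_degree G \/ deg G v = min_degree G) ->
  straus_gap (min_degree G)%:R c = 0 -> forall x, deg G x = min_degree G.
Proof.
move=> c0 edge; rewrite /straus_gap /edge_form.
rewrite [X in _ - X]big1 => [|u _]; last first.
  by rewrite big1 // => v /edge[]->; rewrite subrr ?mul0r ?mulr0.
move/eqP; rewrite subr0 mulf_eq0 (negPf c0) expf_eq0 /= -sum_deg_sub.
rewrite psumr_eq0 => [/allP H x|u _]; last by rewrite subr_ge0 ler_nat min_degree_le.
by apply/eqP; rewrite -(eqr_nat R) -subr_eq0; apply: (implyP (H x (mem_index_enum x))).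
Qed.

End Gap.

Theorem theorem2p2 (R : realType) (d : nat) (G : sgraph 'I_d)
    (Gconn : connected_graph G) (Gdeg : (2 <= min_degree G)%N) :
  (forall alpha beta : R,
     2 <= alpha -> alpha <= (min_degree G)%:R -> (clique_number G)%:R <= beta ->
     (c4 G)%:R <=
       (2 * #|edges G|%:R - alpha * d%:R) ^+ 2 / 8 * (1 - 1 / beta)
       + #|edges G|%:R * (d%:R - alpha ^+ 2 + 1) / 4
       + (alpha - 2) / 4 * (sum_sq_deg G)%:R)
  /\
  ((c4 G)%:R =
       (2 * #|edges G|%:R - (min_degree G)%:R * d%:R) ^+ 2 / 8
         * (1 - 1 / (clique_number G)%:R)
       + #|edges G|%:R * (d%:R - (min_degree G)%:R ^+ 2 + 1) / 4
       + ((min_degree G)%:R - 2) / 4 * (sum_sq_deg G)%:R :> R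
   <->
   isomorphic G (@complete_adj d)
   \/ exists m : nat,
        d = (2 * m)%N /\ isomorphic G (@complete_bipartite_adj m m)).
Proof.
have [/card_gt0P[u _] _] := Gconn.
have /card_gt0P[v] : (0 < deg G u)%N by rewrite (leq_trans _ (min_degree_le G u)) // ltnW.
rewrite inE => Guv; have w2 := clique_edge Guv.
have bound := c4_bound_defect G (R := R); rewrite card_ord in bound.
split=> [alpha beta _ ha hb|].
  rewrite bound lerDl divr_ge0 // addr_ge0 ?ler0n //.
  by apply: straus_gap_ge0 => //; apply: ltnW.
rewrite bound; set c := 1 - _.
have gap0 : 0 <= straus_gap G (min_degree G)%:R c.
  by apply: straus_gap_ge0 => //; apply: ltnW.
(* The edge [uv] makes the clique number at least 2, hence different from 1. *)
have c0 : c != 0.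
  rewrite subr_eq0 eq_sym mul1r invr_eq1 pnatr_eq1.
  by apply/eqP => E; move: w2; rewrite E.
have [y miny] := min_degree_attained G u.
split=> [/eqP|].
  (* Equality makes a sum of two non-negative terms vanish, hence each of them. *)
  rewrite -subr_eq0 opprD addNKr oppr_eq0 mulf_eq0 invr_eq0 pnatr_eq0 orbF.
  rewrite paddr_eq0 ?ler0n // pnatr_eq0 => /andP[/eqP def0 /eqP gapE].
  have [tri|] := boolP [exists a, exists b, exists e, [&& G a b, G a e & G b e]].
    left; case/existsP: tri => a /existsP[b] /existsP[e] /and3P[h1 h2 h3].
    exact/complete_isoP/(triangle_complete def0 h1 h2 h3).
  move=> ntri; right.
  have tf a b e : G a b -> G a e -> ~~ G b e.
    move=> h1 h2; apply: contra ntri => h3.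
    by apply/existsP; exists a; apply/existsP; exists b; apply/existsP; exists e; apply/and3P.
  pose A := [set x | G v x].
  have GE x z : G x z = ((x \in A) (+) (z \in A)).
    by rewrite !inE (triangle_free_bipartite def0 Guv tf).
  have dE := deg_bipartite GE.
  have reg : forall x, deg G x = min_degree G.
    (* Each edge has an end in the class of [y], where all degrees equal that of [y], the
       minimum. *)
    apply: straus_gap_eq0_regular c0 _ gapE => a b.
    rewrite GE miny !dE.
    by case: (a \in A); case: (b \in A); case: (y \in A) => //= _; [left|right|right|left].
  have uA : u \in A by rewrite inE (adj_sym G).
  have vA : (v \in A) = false by rewrite inE (adj_irr G).
  (* The degrees of [u] and [v], which lie in opposite classes, are the sizes of the two classes. *)
  have cC : #|~: A| = min_degree G by rewrite -(reg u) dE uA.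
  have cA : #|A| = min_degree G by rewrite -(reg v) dE vA.
  exists (min_degree G); split; last by apply/complete_bipartite_isoP; exists A.
  by rewrite mul2n -addnn -{1}cA -cC cardsC card_ord.
(* Both families are regular with zero deficit, so both defect terms vanish. *)
move=> iso; have [k reg def0] : exists2 k, forall x, deg G x = k & total_deficit G = 0%N.
  case: iso => [/complete_isoP GE | [m [_ /complete_bipartite_isoP[A [cA cC GE]]]]].
    by exists #|'I_d|.-1; [apply: deg_complete | apply: complete_total_deficit].
  exists m; last exact: bipartite_total_deficit GE.
  by move=> x; rewrite (deg_bipartite GE) cA cC if_same.
by rewrite miny reg regular_straus_gap // def0 addr0 mul0r addr0.
Qed.
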